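(* Let $L$ be a selfadjoint operator on the complex Hilbert space $\mathcal{H}$ with $L\ge 0$. Let $f,g\in\mathcal{H}$ with $f,g\in D(L^n)$ for all natural numbers $n$ be given. Then the estimate $$\left|\langle f,e^{-tL}g\rangle-(-t)^n\cdot\frac{\langle f,L^ng\rangle}{n!}\right|\le t^{n+1}\cdot\frac{\langle f,L^{n+1}f\rangle+\langle g,L^{n+1}g\rangle}{2\cdot(n+1)!}$$ holds for all natural numbers $n\le d_L(f,g)$ and all $t\ge 0$.
   Context: $D(A)$ denotes the domain of an operator $A$; $L^n$ and $e^{-tL}$ are defined by the spectral calculus, with $L^0$ the identity. Natural numbers include $0$, and $0^0=1$. For $f,g\in\mathcal{H}$ with $f,g\in D(L^n)$ for all natural numbers $n$, $$d_L(f,g):=\inf\{n : \langle f,L^ng\rangle\ne 0\},$$ where $n$ ranges over the natural numbers and the infimum over the empty set is $\infty$. If $d_L(f,g)=\infty$, then ''$n\le d_L(f,g)$'' means every natural number $n$. *)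

(* Defs.v *)
From mathcomp Require Import all_boot all_order all_algebra.
From mathcomp Require Export sesquilinear complex.
From mathcomp Require Import all_classical all_reals all_analysis.

Set Implicit Arguments.
Unset Strict Implicit.
Unset Printing Implicit Defensive.

Import Order.TTheory GRing.Theory Num.Theory Num.Def.
Import numFieldNormedType.Exports HBSimple.

Local Open Scope classical_set_scope.
Local Open Scope ring_scope.
Local Open Scope complex_scope.

(* A complex Hilbert space is a complete normed module [H] over [R[i]] together
   with a positive definite hermitian form [ip] inducing the norm.  MathComp's
   forms are linear in the first and conjugate-linear in the second argument. *)
Definition induces_norm (R : realType) (H : completeNormedModType R[i])
    (ip : {dot H for conjC}) : Prop :=
  forall x : H, ip x x = `|x| ^+ 2.

Section Operators.
Variables (R : realType) (H : completeNormedModType R[i]).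
Variable ip : {dot H for conjC}.

(* A possibly unbounded operator; only the values on [dom] are meaningful, so
   operators are compared through their graphs. *)
Record operator := Operator { dom : set H; op_fun :> H -> H }.

Definition graph (T : operator) : set (H * H) :=
  [set p | dom T p.1 /\ p.2 = T p.1].

Definition linear_operator (T : operator) : Prop :=
  dom T 0 /\
  forall (a : R[i]) (x y : H), dom T x -> dom T y ->
    dom T (a *: x + y) /\ T (a *: x + y) = a *: T x + T y.

Definition adjoint_graph (T : operator) : set (H * H) :=
  [set p | forall x, dom T x -> ip (T x) p.1 = ip x p.2].

Definition selfadjoint (T : operator) : Prop :=
  [/\ linear_operator T, dense (dom T) & adjoint_graph T = graph T].

(* The order on [R[i]] makes this say that [ip x (T x)] is real and >= 0. *)
Definition nonneg_operator (T : operator) : Prop :=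
  forall x, dom T x -> 0 <= ip x (T x).

Definition orthogonal_projection (P : H -> H) : Prop :=
  [/\ linear P, forall x, P (P x) = P x & forall x y, ip (P x) y = ip x (P y)].

Local Notation operator_valued := (set (measurableTypeR R) -> H -> H).

(* Projection-valued measures on the Borel sets of the real line; countable
   additivity is in the strong operator topology. *)
Definition projection_valued_measure (E : operator_valued) : Prop :=
  [/\ forall A, measurable A -> orthogonal_projection (E A),
      forall x, E set0 x = 0 /\ E setT x = x,
      forall A B, measurable A -> measurable B ->
        forall x, E (A `&` B) x = E A (E B x) &
      forall F : (set (measurableTypeR R))^nat,
        (forall i, measurable (F i)) -> trivIset setT F ->
        forall x, series (fun i => E (F i) x) @ \oo --> E (\bigcup_i F i) x].

(* A |-> <x, E(A) x>, written as the squared norm of E(A) x. *)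
Definition scalar_spectral_measure (E : operator_valued) (x : H)
    (A : set (measurableTypeR R)) : \bar R :=
  (complex.Re (`|E A x| ^+ 2))%:E.

Definition simple_spectral_integral (E : operator_valued)
    (s : {sfun measurableTypeR R >-> R}) (x : H) : H :=
  \sum_(c \in range s) (c%:C *: E (s @^-1` [set c]) x).

Definition L2_approximates (E : operator_valued) (x : H) (phi : R -> R)
    (s : {sfun measurableTypeR R >-> R}^nat) : Prop :=
  (\int[scalar_spectral_measure E x]_l (((phi l - s k l) ^+ 2)%:E))%E
    @[k --> \oo] --> 0%E.

(* The spectral integral of a real Borel function phi: its domain consists of
   the x for which phi is square-integrable against <x, E(.) x>, and its value
   at x is the limit of the integrals of simple functions converging to phi in
   that L^2 space (such approximations exist, and the limit does not depend on
   the one chosen). *)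
Definition spectral_integral (E : operator_valued) (phi : R -> R) : operator :=
  Operator
    [set x | (\int[scalar_spectral_measure E x]_l (((phi l) ^+ 2)%:E) < +oo)%E]
    (fun x => xget 0 [set y | exists s : {sfun measurableTypeR R >-> R}^nat,
       L2_approximates E x phi s /\
       simple_spectral_integral E (s k) x @[k --> \oo] --> y]).

Definition is_spectral_measure (L : operator) (E : operator_valued) : Prop :=
  projection_valued_measure E /\ graph L = graph (spectral_integral E id).

(* By the spectral theorem, a selfadjoint operator has exactly one spectral
   measure, and this is it. *)
Definition spectral_measure (L : operator) : operator_valued :=
  xget ((fun _ => id) : operator_valued) [set E | is_spectral_measure L E].

(* The operator phi(L).  For an operator without a spectral measure, phi(L) is
   undefined, that is, has empty domain; selfadjoint operators always have
   one. *)
Definition functional_calculus (L : operator) (phi : R -> R) : operator :=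
  Operator
    [set x | is_spectral_measure L (spectral_measure L) /\
             dom (spectral_integral (spectral_measure L) phi) x]
    (spectral_integral (spectral_measure L) phi).

Definition op_pow (L : operator) (n : nat) : operator :=
  functional_calculus L (fun l => l ^+ n).

(* e^{-tL} *)
Definition heat_op (t : R) (L : operator) : operator :=
  functional_calculus L (fun l => expR (- t * l)).

(* [ereal_inf set0 = +oo]. *)
Definition d_op (L : operator) (f g : H) : \bar R :=
  ereal_inf [set n%:R%:E | n in [set n : nat | ip f (op_pow L n g) != 0]].

End Operators.

(* Main.v *)
From HB Require Import structures.
Require Import Defs.
From mathcomp Require Import all_boot all_order all_algebra finmap.
From mathcomp Require Import all_classical all_reals all_analysis.
From mathcomp Require Import measurable_realfun ring lra.
Set Implicit Arguments.
Unset Strict Implicit.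
Unset Printing Implicit Defensive.
Import Order.TTheory GRing.Theory Num.Theory Num.Def numFieldNormedType.Exports.
Import HBSimple HBNNSimple.
Local Open Scope classical_set_scope.
Local Open Scope ring_scope.
Local Open Scope complex_scope.

(** The estimate is a Taylor bound for the Laplace transform of a positive
    measure, transferred to a pair of vectors by polarization.

    Let [E] be the spectral measure of [L] and, for a vector [z], let [mu z] be
    the scalar measure A |-> <z, E(A) z>.  For a real Borel function phi the
    operator phi(L) satisfies <z, phi(L) z> = int phi d(mu z)
    ([ip_spectral_integral]).  Since L >= 0, the measure [mu z] charges no
    negative number ([nonneg_spectral_mu]); and for l >= 0 the remainder of the
    exponential series alternates, so that
       |e^{-tl} - sum_(k <= n) (-tl)^k / k!| <= (tl)^(n+1) / (n+1)!
    ([expR_taylor_alternating]).  Integrating gives, for every [z] in the domain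
    of all powers of [L],
       |D z| <= t^(n+1) / (n+1)! * <z, L^(n+1) z>,
    where D z = <z, e^{-tL} z> - sum_(k <= n) (-t)^k / k! <z, L^k z>
    ([integral_exp_taylor]).

    For n <= d_L(f, g) the numbers <f, L^k g> with k < n vanish, so the quantity
    T to be estimated is <f, e^{-tL} g> minus the whole Taylor polynomial.
    Choose a phase a with a T = |T|.  Then |T| is a real part, and polarization
    ([spectral_integral_polarization]) writes it as
    (D (a f + g) - D (a f - g)) / 4.  Bounding both terms, and adding the
    diagonal values of L^(n+1) at a f + g and a f - g by the parallelogram law
    ([spectral_integral_parallelogram]), gives exactly the right-hand side.

    The operators phi(L) are defined through limits of integrals of simple
    functions, so their linearity, symmetry and diagonal values have to be
    proved.  The integral S(s) of a simple function s obeys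
    |S(s) x|^2 = int s^2 d(mu x); hence an L^2-approximating sequence gives a
    Cauchy sequence of vectors whose limit depends on phi and x alone
    ([L2_approximates_cvg], [L2_approximates_unique]).  As one sequence of
    simple functions can be used for all vectors of the domain
    ([spectral_integral_approx]), the identities pass to the limit. *)

(** * The alternating Taylor bound for the exponential *)

Section Taylor.
Variable R : realType.

(** The remainder after [m] terms of the series of [expR (- u)], multiplied by
    [(-1) ^+ m]; this sign makes it nonnegative, and the recursion exhibits the
    next remainder as the next term minus the current one. *)
Fixpoint exp_rem (m : nat) (u : R) : R :=
  if m is k.+1 then u ^+ k / k`!%:R - exp_rem k u else expR (- u).

Lemma exp_remE m u :
  exp_rem m u = (-1) ^+ m * (expR (- u) - \sum_(k < m) (- u) ^+ k / k`!%:R).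
Proof.
elim: m => [|m IH] /=; first by rewrite big_ord0 subr0 mul1r.
rewrite IH big_ord_recr /= exprS.
have -> : (- u) ^+ m = (-1) ^+ m * u ^+ m by rewrite -exprMn mulN1r.
have e : (-1) ^+ m * (-1) ^+ m = 1 :> R by rewrite -exprMn mulrNN mulr1 expr1n.
set S := \sum_(_ < _) _; set a : R := (-1) ^+ m in e *; set F := _^-1.
transitivity (a * a * u ^+ m * F - a * (expR (- u) - S)).
  by rewrite e mul1r.
ring.
Qed.

Lemma is_derive_exp_rem m (u : R) :
  is_derive u 1 (exp_rem m.+1) (exp_rem m u).
Proof.
elim: m => [|m IH].
  have -> : exp_rem 1 = cst 1 - (expR \o -%R).
    by apply/funext => v; rewrite /= fctE /= expr0 divr1.
  apply: is_derive_eq.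
  by rewrite sub0r mulrN1 opprK.
apply: (@is_deriveB _ _ _ (fun v : R => v ^+ m.+1 / m.+1`!%:R) (exp_rem m.+1)).
have -> : (fun v : R => v ^+ m.+1 / m.+1`!%:R) =
    (m.+1`!%:R)^-1 *: ((@id R : R -> R) ^+ m.+1).
  by apply/funext => v; rewrite !fctE /GRing.scale /= mulrC.
apply: is_derive_eq.
rewrite factS natrM invfM /GRing.scale /= mulr1.
by rewrite mulrACA mulVf ?pnatr_eq0// mul1r mulrC.
Qed.

Lemma exp_rem0 m : exp_rem m.+1 0 = 0.
Proof.
elim: m => [|m IH]; first by rewrite /= oppr0 expR0 expr0 divr1 subrr.
by rewrite -[LHS]/(_ - exp_rem m.+1 0) IH exprS mul0r mul0r subrr.
Qed.

(** Each remainder of positive index vanishes at 0 and is a primitive of the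
    preceding one, hence inherits its sign. *)
Lemma exp_rem_ge0 m (u : R) : 0 <= u -> 0 <= exp_rem m u.
Proof.
elim: m u => [|m IH] u u0; first exact: expR_ge0.
rewrite -(exp_rem0 m).
have d x : derivable (exp_rem m.+1) x 1 by have [] := is_derive_exp_rem m x.
apply: (@ger0_derive1_le_cc _ (exp_rem m.+1) 0 u) => //.
- move=> x; rewrite in_itv /= => /andP[/ltW x0 _].
  by rewrite derive1E (@derive_val _ _ _ _ _ _ _ (is_derive_exp_rem m x)) IH.
- apply: continuous_subspaceT => x; apply: differentiable_continuous.
  exact/derivable1_diffP.
- by rewrite in_itv /= lexx u0.
- by rewrite in_itv /= lexx u0.
Qed.

(** Two consecutive remainders are nonnegative, and their sum is the next term
    of the series: so that term bounds each of them. *)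
Lemma expR_taylor_alternating n (u : R) : 0 <= u ->
  `|expR (- u) - \sum_(k < n.+1) (- u) ^+ k / k`!%:R| <= u ^+ n.+1 / n.+1`!%:R.
Proof.
move=> u0; have r0 := exp_rem_ge0 n.+1 u0.
have r1 : 0 <= u ^+ n.+1 / n.+1`!%:R - exp_rem n.+1 u := exp_rem_ge0 n.+2 u0.
rewrite subr_ge0 -(ger0_norm r0) exp_remE normrM in r1.
apply: le_trans r1.
by rewrite normrX normrN1 expr1n mul1r.
Qed.

End Taylor.

(** * Dominated approximation by simple functions *)

Section Approx.
Context d (T : measurableType d) (R : realType).

(** The positive and negative parts are approximated separately from below, so
    every approximant lies between 0 and [phi]; hence the domination. *)
Lemma sfun_approx_dominated (phi : T -> R) : measurable_fun setT phi ->
  exists s : {sfun T >-> R}^nat,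
    (forall x, s k x @[k --> \oo] --> phi x) /\
    (forall k x, `|phi x - s k x| <= `|phi x|).
Proof.
move=> mphi.
have approx_ge0 (f : T -> R) : measurable_fun setT f -> (forall x, 0 <= f x) ->
    exists p : {nnsfun T >-> R}^nat, (forall x, p k x @[k --> \oo] --> f x) /\
      (forall k x, p k x <= f x).
  move=> mf f0.
  have mfE : measurable_fun setT (EFin \o f) by exact/measurable_EFinP.
  exists (nnsfun_approx measurableT mfE); split => [x|k x].
    have /fine_cvgP[] // :
        EFin \o (nnsfun_approx measurableT mfE)^~ x @ \oo --> (f x)%:E.
    by apply: cvg_nnsfun_approx => // y _; rewrite lee_fin.
  rewrite nnsfun_approxE -lee_fin.
  apply: le_approx => // y _; rewrite lee_fin; exact: f0.
have mpos : measurable_fun setT (phi \max cst 0) by exact: measurable_maxr.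
have mneg : measurable_fun setT ((\- phi) \max cst 0).
  by apply: measurable_maxr => //; exact: measurableT_comp.
have max_ge0 (r : R) : 0 <= Num.max r 0 by rewrite le_max lexx orbT.
have [p [pc pl]] := approx_ge0 _ mpos (fun x => max_ge0 _).
have [q [qc ql]] := approx_ge0 _ mneg (fun x => max_ge0 _).
have phiE x : phi x = (phi \max cst 0) x - ((\- phi) \max cst 0) x.
  by rewrite /= /Num.max; case: ltgtP => h; case: ltgtP => h'; lra.
exists (fun k => (p k : {sfun T >-> R}) - (q k : {sfun T >-> R})).
split => [x|k x].
  by rewrite [phi x]phiE; apply: (cvgB (pc x) (qc x)).
have := pl k x; have := ql k x.
have : 0 <= p k x by [].
have : 0 <= q k x by [].
rewrite sfunB /= /Num.max; case: ltP => h; case: ltP => h' *.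
- lra.
- rewrite !ger0_norm; lra.
- rewrite !ler0_norm; lra.
- have -> : phi x = 0 by lra.
  by rewrite normr0 normr_le0; apply/eqP; lra.
Qed.

End Approx.

(** * The real inner product of a complex Hilbert space *)

Section RealInnerProduct.
Variables (R : realType) (H : completeNormedModType R[i]).
Variable ip : {dot H for conjC}.
Hypothesis ip_norm : induces_norm ip.
Implicit Types x y z : H.

Definition re_ip x y : R := complex.Re (ip x y).

Local Notation rip := re_ip.

Definition rnorm x : R := complex.Re `|x|.

Lemma ipC x y : ip x y = (ip y x)^*%C.
Proof. by rewrite hermC expr0 mul1r. Qed.

Lemma ReD (a b : R[i]) : complex.Re (a + b) = complex.Re a + complex.Re b.
Proof. by case: a b => [? ?] [? ?]. Qed.

Lemma ReN (a : R[i]) : complex.Re (- a) = - complex.Re a.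
Proof. by case: a. Qed.

Lemma ReZ (a : R) (b : R[i]) : complex.Re (a%:C * b) = a * complex.Re b.
Proof. by case: b => [? ?] /=; rewrite mul0r subr0. Qed.

Lemma Re_sum (I : Type) (r : seq I) (F : I -> R[i]) :
  complex.Re (\sum_(k <- r) F k) = \sum_(k <- r) complex.Re (F k).
Proof. by elim/big_rec2: _ => // k y z _ <-; rewrite ReD. Qed.

Lemma ripC x y : rip x y = rip y x.
Proof. by rewrite /re_ip ipC; case: (ip y x). Qed.

Lemma ripDl x y z : rip (x + y) z = rip x z + rip y z.
Proof. by rewrite /re_ip linearDl ReD. Qed.

Lemma ripNl x z : rip (- x) z = - rip x z.
Proof. by rewrite /re_ip linearNl ReN. Qed.

Lemma ripZl (a : R) x z : rip (a%:C *: x) z = a * rip x z.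
Proof. by rewrite /re_ip linearZl_LR ReZ. Qed.

Lemma rip0l x : rip 0 x = 0.
Proof. by rewrite -(scale0r x) ripZl mul0r. Qed.

Lemma ripDr x y z : rip z (x + y) = rip z x + rip z y.
Proof. by rewrite !(ripC z) ripDl. Qed.

Lemma ripNr x z : rip z (- x) = - rip z x.
Proof. by rewrite !(ripC z) ripNl. Qed.

Lemma ripZr (a : R) x z : rip z (a%:C *: x) = a * rip z x.
Proof. by rewrite !(ripC z) ripZl. Qed.

Lemma rnormE x : `|x| = (rnorm x)%:C.
Proof. by rewrite /rnorm RRe_real// ger0_real. Qed.

Lemma rnorm_ge0 x : 0 <= rnorm x.
Proof. by rewrite -ler0c -rnormE. Qed.

Lemma sqr_rnorm x : rnorm x ^+ 2 = rip x x.
Proof. by rewrite /re_ip ip_norm rnormE -rmorphXn. Qed.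

Lemma rip_ge0 x : 0 <= rip x x.
Proof. by rewrite -sqr_rnorm sqr_ge0. Qed.

Lemma ip_self x : ip x x = (rip x x)%:C.
Proof. by rewrite ip_norm rnormE -rmorphXn /= sqr_rnorm. Qed.

Lemma rip_eq0 x : rip x x = 0 -> x = 0.
Proof.
rewrite -sqr_rnorm => /eqP; rewrite sqrf_eq0 => /eqP x0.
by apply/normr0_eq0; rewrite rnormE x0.
Qed.

Lemma rip_parallelogram x y :
  rip (x + y) (x + y) + rip (x - y) (x - y) = 2 * (rip x x + rip y y).
Proof. by rewrite !ripDl !ripDr !ripNl !ripNr; ring. Qed.

Lemma CauchySchwarz_rip x y : `|rip x y| <= rnorm x * rnorm y.
Proof.
rewrite -ler_sqr ?nnegrE ?mulr_ge0 ?rnorm_ge0// real_normK ?num_real//.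
rewrite exprMn !sqr_rnorm.
have [y0|y0] := eqVneq (rip y y) 0.
  by rewrite (rip_eq0 y0) ripC !rip0l expr0n mulr0.
have ygt0 : 0 < rip y y by rewrite lt_neqAle eq_sym y0 rip_ge0.
(* The component of [x] orthogonal to [y], multiplied by the square norm of
   [y]. *)
have := rip_ge0 ((rip y y)%:C *: x - (rip x y)%:C *: y).
rewrite !(ripDl,ripDr,ripNl,ripNr,ripZl,ripZr) (ripC y x).
set a := rip x x; set b := rip x y; set c := rip y y => h.
have : 0 <= c * (a * c - b ^+ 2).
  by apply: le_trans h _; rewrite le_eqVlt; apply/orP; left; apply/eqP; ring.
by rewrite pmulr_rge0// subr_ge0.
Qed.

Lemma rip_cvgl (u : H^nat) (l y : H) :
  u k @[k --> \oo] --> l -> rip (u k) y @[k --> \oo] --> rip l y.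
Proof.
move=> ul; apply/cvgrPdist_lt => e e0.
(* Adding 1 keeps the denominator positive when [y] is 0. *)
have d0 : 0 < e / (rnorm y + 1) by rewrite divr_gt0// ltr_wpDl// rnorm_ge0.
have d0' : (0 : R[i]) < (e / (rnorm y + 1))%:C by rewrite ltcR.
move/cvgrPdist_lt : ul => /(_ _ d0'); apply: filterS => k.
rewrite rnormE ltcR -ripNl -ripDl => h.
apply: le_lt_trans (CauchySchwarz_rip _ _) _.
rewrite ltr_pdivlMr ?ltr_wpDl ?rnorm_ge0// in h.
apply: le_lt_trans h; rewrite ler_wpM2l ?rnorm_ge0//; lra.
Qed.

Lemma sqnorm_cvg (u : H^nat) (l : H) :
  rip (l - u k) (l - u k) @[k --> \oo] --> 0 -> u k @[k --> \oo] --> l.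
Proof.
move=> ul; apply/cvgrPdist_lt => e e0.
(* The norm of [H] takes its values in [R[i]], where a positive radius is the
   image of its real part. *)
have eE : e = (complex.Re e)%:C by rewrite RRe_real// gtr0_real.
move: e0; rewrite eE ltcR; set d := complex.Re e => d0.
have d20 : 0 < d ^+ 2 by rewrite exprn_gt0.
move/cvgrPdist_lt : ul => /(_ _ d20); apply: filterS => k.
rewrite sub0r normrN -sqr_rnorm ger0_norm ?sqr_ge0// rnormE ltcR.
by rewrite ltr_sqr ?nnegrE ?rnorm_ge0// ltW.
Qed.

Lemma sqnorm_cauchy_cvg (u : H^nat) :
  (forall e : R, 0 < e -> exists N, forall j k, (N <= j)%N -> (N <= k)%N ->
    rip (u j - u k) (u j - u k) < e) -> cvg (u k @[k --> \oo]).
Proof.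
move=> uc; apply: cauchy_cvg; apply/cauchy_ballP => e e0.
have eE : e = (complex.Re e)%:C by rewrite RRe_real// gtr0_real.
move: e0; rewrite eE ltcR; set d := complex.Re e => d0.
have d20 : 0 < d ^+ 2 by rewrite exprn_gt0.
have [N uN] := uc _ d20.
exists (u @` [set k | (N <= k)%N], u @` [set k | (N <= k)%N]).
  by split; exists N => // k /= Nk; exists k.
move=> [_ _] /= [[j Nj <-] [k Nk <-]]; rewrite -ball_normE /=.
rewrite rnormE ltcR -ltr_sqr ?nnegrE ?rnorm_ge0 ?(ltW d0)//.
by rewrite sqr_rnorm uN.
Qed.

End RealInnerProduct.

(** * Integration against a finite measure *)

Section FiniteMeasure.
Context d (T : measurableType d) (R : realType).
Variable mu : {finite_measure set T -> \bar R}.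

(** Constants are integrable for a finite measure, and |phi| <= 1 + phi^2. *)
Lemma integrable_square (phi : T -> R) : measurable_fun setT phi ->
  (\int[mu]_l (phi l ^+ 2)%:E < +oo)%E -> mu.-integrable setT (EFin \o phi).
Proof.
move=> mphi sqfin.
have i2 : mu.-integrable setT (fun l => (phi l ^+ 2)%:E).
  apply/integrableP; split; first exact/measurable_EFinP/measurable_funX.
  by under eq_integral do rewrite gee0_abs ?lee_fin ?sqr_ge0//.
apply: (@le_integrable _ _ _ mu setT measurableT _
    (fun l => ((cst 1 l)%:E + (phi l ^+ 2)%:E)%E)); last 1 first.
- have i1 := finite_measure_integrable_cst mu 1 measurableT.
  exact: (integrableD measurableT i1 i2).
- exact/measurable_EFinP.
- move=> l _; rewrite /= lee_fin [leRHS]ger0_norm ?addr_ge0 ?sqr_ge0//.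
  rewrite -(real_normK (num_real (phi l))); set a := `|_|.
  by have := sqr_ge0 (a - 1); have := sqr_ge0 a; rewrite !expr2; lra.
Qed.

(** The cases where [g] is the identity and the square are the two integrals by
    which a spectral integral of [s] is known: its diagonal values and its
    square norm. *)
Lemma sfun_comp_Rintegral (s : {sfun T >-> R}) (g : R -> R) :
  mu.-integrable setT (fun l => (g (s l))%:E) /\
  \int[mu]_l g (s l) =
  \sum_(c <- fset_set (range s)) g c * fine (mu (s @^-1` [set c])).
Proof.
have fs : finite_set (range s) by exact: fimfunP.
have gE l : (g (s l))%:E =
    (\sum_(c <- fset_set (range s)) (g c)%:E * (\1_(s @^-1` [set c]) l)%:E)%E.
  rewrite (big_fsetD1 (s l)) /=; last by rewrite in_fset_set// inE; exists l.
  rewrite indicE mem_set//= mule1 big1_seq ?adde0// => c /andP[_].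
  rewrite !inE /= => /andP[/eqP cs _]; rewrite indicE memNset ?mule0//=.
  by move=> /esym.
have ic c : mu.-integrable setT
    (fun l => ((g c)%:E * (\1_(s @^-1` [set c]) l)%:E)%E).
  apply: integrableZl => //; exact: integrable_indic.
split.
  rewrite (_ : (fun l => _) = fun l => (\sum_(c <- fset_set (range s))
      (g c)%:E * (\1_(s @^-1` [set c]) l)%:E)%E).
    exact: integrable_sum.
  by apply/funext => l; exact: gE.
rewrite /Rintegral (eq_integral _ _ (fun l _ => gE l)) integral_sum//.
rewrite -sum_fine => [|c _]; last exact: integrable_fin_num.
apply: eq_bigr => c _; rewrite integralZl//; last exact: integrable_indic.
by rewrite integral_indic// setIT fineM// fin_num_measure.
Qed.

End FiniteMeasure.

(** * Scalar spectral measures *)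

Section PVM.
Variables (R : realType) (H : completeNormedModType R[i]).
Variable ip : {dot H for conjC}.
Hypothesis ip_norm : induces_norm ip.
Variable E : set (measurableTypeR R) -> H -> H.
Hypothesis hE : projection_valued_measure ip E.
Implicit Types x y z : H.
Local Notation rip := (re_ip ip).

Lemma pvmP A (mA : measurable A) (a : R[i]) x y :
  E A (a *: x + y) = a *: E A x + E A y.
Proof. by have [/(_ _ mA)[l _ _] _ _ _] := hE; rewrite l. Qed.

Lemma pvm0 A (mA : measurable A) : E A 0 = 0.
Proof. by have := pvmP mA (-1) 0 0; rewrite !scaleN1r !addNr. Qed.

Lemma pvmZ A (mA : measurable A) (a : R[i]) x : E A (a *: x) = a *: E A x.
Proof. by have := pvmP mA a x 0; rewrite pvm0// !addr0. Qed.

Lemma pvmD A (mA : measurable A) x y : E A (x + y) = E A x + E A y.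
Proof. by have := pvmP mA 1 x y; rewrite !scale1r. Qed.

Lemma pvm_rip_sym A (mA : measurable A) x y : rip (E A x) y = rip x (E A y).
Proof. by have [/(_ _ mA)[_ _ s] _ _ _] := hE; rewrite /re_ip s. Qed.

Lemma pvmI A B (mA : measurable A) (mB : measurable B) x :
  E A (E B x) = E (A `&` B) x.
Proof. by have [_ _ + _] := hE => /(_ _ _ mA mB). Qed.

Lemma pvm_rip A B (mA : measurable A) (mB : measurable B) x y :
  rip (E A x) (E B y) = rip x (E (A `&` B) y).
Proof. by rewrite pvm_rip_sym// pvmI. Qed.

Lemma scalar_spectral_measureE A x (mA : measurable A) :
  scalar_spectral_measure E x A = (rip x (E A x))%:E.
Proof.
rewrite /scalar_spectral_measure -ip_norm.
by rewrite -[complex.Re _]/(rip (E A x) (E A x)) pvm_rip// setIid.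
Qed.

(** The two proofs are arguments of the set function so that its measure
    structure, which depends on them, can be found by inference. *)
Definition spectral_mu of projection_valued_measure ip E & induces_norm ip :=
  scalar_spectral_measure E.

Local Notation mu := (spectral_mu hE ip_norm).

Let mu0 x : mu x set0 = 0%E.
Proof.
have [_ /(_ x)[E0 _] _ _] := hE.
by rewrite /spectral_mu /scalar_spectral_measure E0 normr0 expr0n.
Qed.

Let mu_ge0 x A : (0 <= mu x A)%E.
Proof.
by rewrite lee_fin -ip_norm (ip_self ip_norm)/= (rip_ge0 ip_norm).
Qed.

(** Strong countable additivity of [E] at [x], paired with [x]. *)
Let mu_sigma_additive x : semi_sigma_additive (mu x).
Proof.
move=> F mF tF mUF; have [_ _ _ /(_ F mF tF x) EF] := hE.
rewrite /spectral_mu scalar_spectral_measureE// ripC.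
rewrite (_ : (fun n => _) =
    EFin \o (fun n => rip (series (fun i => E (F i) x) n) x)).
  apply/cvg_EFin; first exact: nearW.
  exact: (rip_cvgl ip_norm EF).
apply/funext => n /=; rewrite /series /=.
elim: n => [|n IH]; first by rewrite !big_geq// rip0l.
rewrite !big_nat_recr//= IH ripDl EFinD.
by rewrite scalar_spectral_measureE// (ripC ip x).
Qed.

HB.instance Definition _ x := isMeasure.Build _ _ _ (mu x)
  (mu0 x) (mu_ge0 x) (@mu_sigma_additive x).

Let mu_fin x : fin_num_fun (mu x).
Proof. by move=> A mA; rewrite /spectral_mu scalar_spectral_measureE. Qed.

HB.instance Definition _ x := Measure_isFinite.Build _ _ _ (mu x) (mu_fin x).


Lemma fine_spectral_mu x A : measurable A -> fine (mu x A) = rip x (E A x).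
Proof. by move=> mA; rewrite /spectral_mu scalar_spectral_measureE. Qed.

Lemma spectral_mu_scale (a : R[i]) x A : measurable A ->
  mu (a *: x) A = ((complex.Re `|a| ^+ 2)%:E * mu x A)%E.
Proof.
move=> mA; rewrite /spectral_mu /scalar_spectral_measure pvmZ// normrZ exprMn.
rewrite -EFinM; congr _%:E.
rewrite (rnormE (E A x)).
have -> : `|a| = (complex.Re `|a|)%:C by rewrite RRe_real// ger0_real.
by rewrite -!rmorphXn -rmorphM.
Qed.

(** The parallelogram law for the vectors [E A x] and [E A y]. *)
Lemma spectral_mu_parallelogram x y A : measurable A ->
  (mu (x + y)%R A + mu (x - y)%R A = (2%:E * mu x A + 2%:E * mu y A))%E.
Proof.
move=> mA; rewrite /spectral_mu /scalar_spectral_measure -!ip_norm.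
rewrite -!EFinM -!EFinD; congr _%:E.
rewrite !pvmD// -(scaleN1r y) pvmZ// scaleN1r -mulrDr.
exact: rip_parallelogram.
Qed.

End PVM.

(** * Spectral integrals of simple functions *)

Section SimpleIntegral.
Variables (R : realType) (H : completeNormedModType R[i]).
Variable ip : {dot H for conjC}.
Hypothesis ip_norm : induces_norm ip.
Variable E : set (measurableTypeR R) -> H -> H.
Hypothesis hE : projection_valued_measure ip E.
Implicit Types (x y z : H) (s : {sfun measurableTypeR R >-> R}).
Local Notation rip := (re_ip ip).
Local Notation mu := (spectral_mu hE ip_norm).
Local Notation "'S' s" := (simple_spectral_integral E s)
  (at level 9, s at level 8).

Let fset_sum s x :
  S s x = \sum_(c <- fset_set (range s)) (c%:C *: E (s @^-1` [set c]) x).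
Proof. by rewrite /simple_spectral_integral fsbig_finite. Qed.

Lemma simple_integralD s x y : S s (x + y) = S s x + S s y.
Proof.
rewrite !fset_sum -big_split; apply: eq_bigr => c _.
by rewrite (pvmD hE)// scalerDr.
Qed.

Lemma simple_integralZ s (a : R[i]) x : S s (a *: x) = a *: S s x.
Proof.
rewrite !fset_sum scaler_sumr; apply: eq_bigr => c _.
by rewrite (pvmZ hE)// !scalerA mulrC.
Qed.

Lemma simple_integralN s x : S s (- x) = - S s x.
Proof. by rewrite -scaleN1r simple_integralZ scaleN1r. Qed.

Lemma rip_suml (I : Type) (r : seq I) (F : I -> H) y :
  rip (\sum_(i <- r) F i) y = \sum_(i <- r) rip (F i) y.
Proof.
elim: r => [|i r IH]; first by rewrite !big_nil rip0l.
by rewrite !big_cons ripDl IH.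
Qed.

Lemma simple_integral_sym s x y : rip (S s x) y = rip x (S s y).
Proof.
rewrite [RHS]ripC !fset_sum !rip_suml; apply: eq_bigr => c _.
by rewrite !ripZl (pvm_rip_sym hE)// (ripC ip x).
Qed.

Lemma rip_simple_integral s x : rip (S s x) x = \int[mu x]_l s l.
Proof.
have [_ ->] := sfun_comp_Rintegral (mu x) s id.
rewrite fset_sum rip_suml; apply: eq_bigr => c _.
by rewrite ripZl ripC; congr (_ * _); apply/esym/(fine_spectral_mu ip_norm hE).
Qed.

(** Disjoint level sets of [s] have orthogonal spectral projections, so only the
    diagonal terms of the double sum remain. *)
Lemma sqnorm_simple_integral s x :
  rip (S s x) (S s x) = \int[mu x]_l (s l ^+ 2).
Proof.
have [_ ->] := sfun_comp_Rintegral (mu x) s (fun c => c ^+ 2).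
rewrite {1}fset_sum rip_suml; apply: eq_big_seq => c cs.
rewrite ripZl ripC fset_sum rip_suml.
rewrite (big_fsetD1 c cs) /= big1_seq ?addr0 => [|c' /andP[_]].
  rewrite ripZl (pvm_rip hE)// setIid expr2 -mulrA.
  by do 2 congr (_ * _); apply/esym/(fine_spectral_mu ip_norm hE).
rewrite !inE => /andP[/eqP cc' _].
rewrite ripZl (pvm_rip hE)// (_ : _ `&` _ = set0).
  by have [_ /(_ x)[-> _] _ _] := hE; rewrite ripC rip0l mulr0.
by apply/seteqP; split=> // l [/= -> /cc'].
Qed.

Lemma simple_integral_polarization s x y : rip (S s x) y =
  4^-1 * (\int[mu (x + y)]_l s l - \int[mu (x - y)]_l s l).
Proof.
rewrite -!rip_simple_integral !(simple_integralD,simple_integralN).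
rewrite !(ripDl,ripDr,ripNl,ripNr) (simple_integral_sym s y x) (ripC ip y).
by lra.
Qed.

(** The level sets of [s - s'] cannot be matched with those of [s] and [s'], so
    the two sides are compared weakly: by polarization their inner products with
    any vector are combinations of scalar integrals, which are linear in the
    integrand. *)
Lemma simple_integralB s s' x : S (s - s') x = S s x - S s' x.
Proof.
suff h y : rip (S (s - s') x - (S s x - S s' x)) y = 0.
  by apply/eqP; rewrite -subr_eq0; apply/eqP/(rip_eq0 ip_norm).
have int z : \int[mu z]_l (s - s') l = \int[mu z]_l s l - \int[mu z]_l s' l.
  rewrite -RintegralB//.
  - by have [] := sfun_comp_Rintegral (mu z) s id.
  - by have [] := sfun_comp_Rintegral (mu z) s' id.
by rewrite !(ripDl,ripNl) !simple_integral_polarization !int; ring.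
Qed.

End SimpleIntegral.

(** * Spectral integrals as limits *)

Section SpectralIntegral.
Variables (R : realType) (H : completeNormedModType R[i]).
Variable ip : {dot H for conjC}.
Hypothesis ip_norm : induces_norm ip.
Variable E : set (measurableTypeR R) -> H -> H.
Hypothesis hE : projection_valued_measure ip E.
Implicit Types (x y z : H) (s : {sfun measurableTypeR R >-> R}).
Local Notation rip := (re_ip ip).
Local Notation mu := (spectral_mu hE ip_norm).
Local Notation "'S' s" := (simple_spectral_integral E s)
  (at level 9, s at level 8).
Local Notation Phi := (spectral_integral E).

Variable phi : R -> R.
Hypothesis mphi : measurable_fun setT (phi : measurableTypeR R -> R).

Let msq s :
  measurable_fun setT (fun l : measurableTypeR R => ((phi l - s l) ^+ 2)%:E).
Proof. by apply/measurable_EFinP/measurable_funX/measurable_funB. Qed.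

(** The left-hand side is the integral of (s - s')^2, and (s - s')^2 is at most
    2 (phi - s)^2 + 2 (phi - s')^2.  Both the Cauchy property and the
    uniqueness of the limit follow from this bound. *)
Lemma sqnorm_simple_integral_dist s s' x :
  ((rip (S s x - S s' x) (S s x - S s' x))%:E <=
   2%:E * \int[mu x]_l ((phi l - s l) ^+ 2)%:E +
   2%:E * \int[mu x]_l ((phi l - s' l) ^+ 2)%:E)%E.
Proof.
rewrite -(simple_integralB ip_norm hE) (sqnorm_simple_integral ip_norm hE).
have [int _] := sfun_comp_Rintegral (mu x) (s - s') (fun c => c ^+ 2).
rewrite /Rintegral fineK; last exact: integrable_fin_num.
have ge0 r : (0 <= (r ^+ 2)%:E :> \bar R)%E by rewrite lee_fin sqr_ge0.
rewrite -!ge0_integralZl//.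
rewrite -ge0_integralD//; last 4 first.
- by move=> l _; rewrite mule_ge0.
- exact: measurable_funeM.
- by move=> l _; rewrite mule_ge0.
- exact: measurable_funeM.
apply: ge0_le_integral => //.
- exact: (measurable_int _ int).
- by apply: emeasurable_funD; exact: measurable_funeM.
- move=> l _; rewrite -!EFinM -EFinD lee_fin sfunB /= -subr_ge0.
  set a := phi l; set b := s l; set c := s' l.
  rewrite [leRHS](_ : _ = (2 * a - b - c) ^+ 2); last by ring.
  exact: sqr_ge0.
Qed.

Lemma L2_approximates_dominated x (s : {sfun measurableTypeR R >-> R}^nat) :
  dom (Phi phi) x -> (forall l, s k l @[k --> \oo] --> phi l) ->
  (forall k l, `|phi l - s k l| <= `|phi l|) -> L2_approximates E x phi s.
Proof.
move=> dx sphi slephi.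
have [] // := @dominated_convergence _ _ _ (mu x) setT measurableT
  (fun k l => ((phi l - s k l) ^+ 2)%:E) (cst 0%E) (fun l => (phi l ^+ 2)%:E).
- apply: aeW => l _; apply/fine_cvgP; split; first exact: nearW.
  have : (phi l - s k l) ^+ 2 @[k --> \oo] --> (phi l - phi l) ^+ 2.
    by apply: cvgM; apply: cvgB => //; exact: cvg_cst.
  by rewrite subrr expr0n.
- apply/integrableP; split; first exact/measurable_EFinP/measurable_funX.
  by under eq_integral do rewrite gee0_abs ?lee_fin ?sqr_ge0//.
- apply: aeW => l k _; rewrite /= lee_fin ger0_norm ?sqr_ge0//.
  rewrite -(real_normK (num_real (phi l))) -real_normK ?num_real//.
  by rewrite ler_sqr ?nnegrE.
- by rewrite integral0.
Qed.

Let L2_small x (s : {sfun measurableTypeR R >-> R}^nat) (e : R) :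
  L2_approximates E x phi s -> 0 < e ->
  \forall k \near \oo,
    (2%:E * \int[mu x]_l ((phi l - s k l) ^+ 2)%:E < (e / 2)%:E)%E.
Proof.
move=> /fine_cvgP[fs /cvgrPdist_lt h] e0.
have e40 : 0 < e / 4 by rewrite divr_gt0.
near=> k.
have fk : (\int[mu x]_l ((phi l - s k l) ^+ 2)%:E)%E \is a fin_num.
  by near: k; exact: fs.
have : `|0 - fine (\int[mu x]_l ((phi l - s k l) ^+ 2)%:E)%E| < e / 4.
  by near: k; exact: h.
rewrite -(fineK fk) -EFinM lte_fin sub0r normrN => /ltr_normlW.
by rewrite fineK// => ?; lra.
Unshelve. all: by end_near. Qed.

Lemma L2_approximates_cvg x (s : {sfun measurableTypeR R >-> R}^nat) :
  L2_approximates E x phi s -> cvg (S (s k) x @[k --> \oo]).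
Proof.
move=> sphi; apply: (sqnorm_cauchy_cvg ip_norm) => e e0.
have [N _ hN] := L2_small sphi e0.
exists N => j k Nj Nk; rewrite -lte_fin.
apply: le_lt_trans (sqnorm_simple_integral_dist _ _ _) _.
rewrite [e]splitr [X in (_ < X)%E]EFinD; apply: lteD; exact: hN.
Qed.

Lemma L2_approximates_unique x
    (s s' : {sfun measurableTypeR R >-> R}^nat) y y' :
  L2_approximates E x phi s -> L2_approximates E x phi s' ->
  S (s k) x @[k --> \oo] --> y -> S (s' k) x @[k --> \oo] --> y' -> y = y'.
Proof.
move=> sphi sphi' sy sy'.
have d0 : (S (s k) x - S (s' k) x) @[k --> \oo] --> (0 : H).
  apply: (sqnorm_cvg ip_norm); apply/cvgrPdist_lt => e e0.
  near=> k; rewrite !sub0r ripNl ripNr opprK normrN.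
  rewrite ger0_norm ?(rip_ge0 ip_norm)//.
  rewrite -lte_fin; apply: le_lt_trans (sqnorm_simple_integral_dist _ _ _) _.
  rewrite [e]splitr [X in (_ < X)%E]EFinD; apply: lteD.
    by near: k; exact: L2_small.
  by near: k; exact: L2_small.
apply/eqP; rewrite -subr_eq0; apply/eqP.
exact: (cvg_unique _ (cvgB sy sy') d0).
Unshelve. all: by end_near. Qed.

Lemma spectral_integral_cvg x (s : {sfun measurableTypeR R >-> R}^nat) :
  L2_approximates E x phi s -> S (s k) x @[k --> \oo] --> Phi phi x.
Proof.
move=> sphi; have sc := L2_approximates_cvg sphi.
have [y [s' [sphi' sy]]] :
    exists y, exists s' : {sfun measurableTypeR R >-> R}^nat,
    L2_approximates E x phi s' /\ S (s' k) x @[k --> \oo] --> y.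
  by exists (lim (S (s k) x @[k --> \oo])), s.
rewrite /=; case: xgetP => [z -> [s'' [sphi'' sz]]|/(_ y)[]]; last by exists s'.
by rewrite -(L2_approximates_unique sphi sphi'' sc sz).
Qed.

(** The sequence does not depend on the vector, so identities between spectral
    integrals of simple functions at several vectors pass to the limit. *)
Lemma spectral_integral_approx :
  exists s : {sfun measurableTypeR R >-> R}^nat,
  [/\ forall l, s k l @[k --> \oo] --> phi l,
      forall k l, `|phi l - s k l| <= `|phi l| &
      forall x, dom (Phi phi) x -> S (s k) x @[k --> \oo] --> Phi phi x].
Proof.
have [s [sphi slephi]] := sfun_approx_dominated mphi.
exists s; split => // x dx.
by apply/spectral_integral_cvg/L2_approximates_dominated.
Qed.

Lemma spectral_integral_sym x y : dom (Phi phi) x -> dom (Phi phi) y ->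
  rip (Phi phi x) y = rip x (Phi phi y).
Proof.
move=> dx dy; have [s [_ _ sPhi]] := spectral_integral_approx.
have hx := rip_cvgl ip_norm (y := y) (sPhi x dx).
have := rip_cvgl ip_norm (y := x) (sPhi y dy).
under eq_fun do rewrite (simple_integral_sym hE) ripC.
by move=> hy; rewrite [RHS]ripC; exact: (cvg_unique _ hx hy).
Qed.

(** Dominated convergence: approximants that are closer to [phi] than 0 is are
    bounded by 2 |phi|. *)
Lemma rip_spectral_integral x : dom (Phi phi) x ->
  rip (Phi phi x) x = \int[mu x]_l phi l.
Proof.
move=> dx; have [s [sphi slephi sPhi]] := spectral_integral_approx.
have iphi : (mu x).-integrable setT (EFin \o phi) by exact: integrable_square.
have [] // := @dominated_convergence _ _ _ (mu x) setT measurableT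
  (fun k l => (s k l)%:E) (EFin \o phi)
  (fun l => (2%:E * ((normr \o phi) l)%:E)%E).
- by move=> k; exact/measurable_EFinP.
- exact: (measurable_int _ iphi).
- by apply: aeW => l _; apply/fine_cvgP; split; [exact: nearW|exact: sphi].
- by apply: integrableZl => //; exact: integrable_norm.
- apply: aeW => l k _; rewrite /= -EFinM lee_fin.
  have := slephi k l; have := ler_distD (phi l) 0 (s k l).
  rewrite !sub0r !normrN; lra.
move=> _ _; rewrite -(fineK (integrable_fin_num _ iphi))//.
move=> /fine_cvgP[_ sint].
have := rip_cvgl ip_norm (y := x) (sPhi x dx).
under eq_fun do rewrite (rip_simple_integral ip_norm hE).
by move=> h; exact: (cvg_unique _ h sint).
Qed.

End SpectralIntegral.

(** * Linearity and polarization of spectral integrals *)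

Section Linearity.
Variables (R : realType) (H : completeNormedModType R[i]).
Variable ip : {dot H for conjC}.
Hypothesis ip_norm : induces_norm ip.
Variable E : set (measurableTypeR R) -> H -> H.
Hypothesis hE : projection_valued_measure ip E.
Implicit Types (x y z : H) (s : {sfun measurableTypeR R >-> R}).
Local Notation rip := (re_ip ip).
Local Notation mu := (spectral_mu hE ip_norm).
Local Notation Phi := (spectral_integral E).

Section OneFunction.
Variable phi : R -> R.
Hypothesis mphi : measurable_fun setT (phi : measurableTypeR R -> R).

Let msq : measurable_fun setT (fun l : measurableTypeR R => (phi l ^+ 2)%:E).
Proof. exact/measurable_EFinP/measurable_funX. Qed.

Lemma dom_spectral_integralZ (a : R[i]) x :
  dom (Phi phi) x -> dom (Phi phi) (a *: x).
Proof.
move=> dx; have a2 : 0 <= complex.Re `|a| ^+ 2 by exact: sqr_ge0.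
apply: le_lt_trans
  (_ : (\int[mscale (NngNum a2) (mu x)]_l (phi l ^+ 2)%:E < +oo)%E).
  apply: (@ge0_le_measure_integral _ _ _ (mu (a *: x))) => //.
    by move=> A mA; rewrite /mscale /= spectral_mu_scale.
  by move=> l; rewrite lee_fin sqr_ge0.
rewrite ge0_integral_mscale//; last by move=> l _; rewrite lee_fin sqr_ge0.
by apply: lte_mul_pinfty => //; rewrite lee_fin.
Qed.

(** By the parallelogram law [mu (x + y)] is at most 2 [mu x] + 2 [mu y]. *)
Lemma dom_spectral_integralD x y :
  dom (Phi phi) x -> dom (Phi phi) y -> dom (Phi phi) (x + y).
Proof.
move=> dx dy; pose two := NngNum (ler0n R 2).
have sq_ge0 l : (0 <= (phi l ^+ 2)%:E)%E.
  by rewrite lee_fin sqr_ge0.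
have fin : (\int[measure_add (mscale two (mu x)) (mscale two (mu y))]_l
    (phi l ^+ 2)%:E < +oo)%E.
  rewrite ge0_integral_measure_add// !ge0_integral_mscale//.
  by apply: lte_add_pinfty; apply: lte_mul_pinfty.
apply: le_lt_trans fin.
apply: (@ge0_le_measure_integral _ _ _ (mu (x + y))) => // A mA.
rewrite [leRHS](measure_addE (mscale two (mu x)) (mscale two (mu y))).
rewrite /mscale /=.
rewrite -(spectral_mu_parallelogram ip_norm hE)//.
by rewrite leeDl.
Qed.

Lemma spectral_integral_linear (a : R[i]) x y :
  dom (Phi phi) x -> dom (Phi phi) y ->
  Phi phi (a *: x + y) = a *: Phi phi x + Phi phi y.
Proof.
move=> dx dy; have [s [_ _ sPhi]] := spectral_integral_approx ip_norm hE mphi.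
have := sPhi _ (dom_spectral_integralD (dom_spectral_integralZ a dx) dy).
under eq_fun do rewrite (simple_integralD hE) (simple_integralZ hE).
move=> h; have cx := cvgZl_tmp (k := a) (sPhi x dx).
exact: (cvg_unique _ h (cvgD (cx _) (sPhi y dy))).
Qed.

Lemma spectral_integralZ (a : R[i]) x : dom (Phi phi) x ->
  Phi phi (a *: x) = a *: Phi phi x.
Proof.
move=> dx; have d0 : dom (Phi phi) 0.
  by rewrite -(scale0r x); exact: dom_spectral_integralZ.
have P0 : Phi phi 0 = 0.
  have := spectral_integral_linear (-1) d0 d0.
  by rewrite !scaleN1r oppr0 addr0 addNr.
by have := spectral_integral_linear a dx d0; rewrite P0 !addr0.
Qed.

(** Symmetry of the real form, tested on [x] and ['i *: x], makes the imaginary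
    part equal to its opposite. *)
Lemma ip_spectral_integral x : dom (Phi phi) x ->
  ip x (Phi phi x) = (\int[mu x]_l phi l)%:C.
Proof.
move=> dx; have dix := dom_spectral_integralZ 'i dx.
have := spectral_integral_sym ip_norm hE mphi dx dix.
rewrite spectral_integralZ// -(rip_spectral_integral ip_norm hE mphi)//.
rewrite /re_ip !linearZr_LR/= (ipC ip (Phi phi x)).
case: (ip x (Phi phi x)) => [a b] /=.
rewrite !mul0r !sub0r !mulN1r !opprK => h.
by congr (_ +i* _); lra.
Qed.

Lemma spectral_integral_polarization x y :
  dom (Phi phi) x -> dom (Phi phi) y -> rip x (Phi phi y) =
  4^-1 * (\int[mu (x + y)]_l phi l - \int[mu (x - y)]_l phi l).
Proof.
move=> dx dy; have dN : dom (Phi phi) (- y).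
  by rewrite -scaleN1r; exact: dom_spectral_integralZ.
rewrite -!(rip_spectral_integral ip_norm hE mphi);
  try exact: dom_spectral_integralD.
have D u v : dom (Phi phi) u -> dom (Phi phi) v ->
    Phi phi (u + v) = Phi phi u + Phi phi v.
  by move=> du dv; have := spectral_integral_linear 1 du dv; rewrite !scale1r.
rewrite !D// -(scaleN1r y) spectral_integralZ// !scaleN1r.
rewrite !(ripDl,ripDr,ripNl,ripNr) (ripC ip (Phi phi y) x).
by rewrite (spectral_integral_sym ip_norm hE mphi dx dy); lra.
Qed.

Lemma spectral_integral_parallelogram (a : R[i]) x y : `|a| = 1 ->
  dom (Phi phi) x -> dom (Phi phi) y ->
  \int[mu (a *: x + y)]_l phi l + \int[mu (a *: x - y)]_l phi l =
  2 * (\int[mu x]_l phi l + \int[mu y]_l phi l).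
Proof.
move=> a1 dx dy; have dN : dom (Phi phi) (- y).
  by rewrite -scaleN1r; exact: dom_spectral_integralZ.
have da := dom_spectral_integralZ a dx.
rewrite -!(rip_spectral_integral ip_norm hE mphi)//;
  try exact: dom_spectral_integralD.
rewrite !spectral_integral_linear// -(scaleN1r y) spectral_integralZ//.
rewrite !scaleN1r.
have -> : rip (Phi phi x) x = rip (a *: Phi phi x) (a *: x).
  by rewrite /re_ip linearZl_LR linearZr_LR /= mulrA -normCK a1 expr1n mul1r.
by rewrite !(ripDl,ripDr,ripNl,ripNr); ring.
Qed.

End OneFunction.

End Linearity.

(** * Laplace transforms of measures on the half-line *)

Section LaplaceTaylor.
Variable R : realType.
Variable mu : {finite_measure set (measurableTypeR R) -> \bar R}.
Local Notation neg := (`]-oo, 0[%classic : set (measurableTypeR R)).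
Hypothesis mu_neg : mu neg = 0%E.

Let mneg : measurable neg. Proof. exact: measurable_itv. Qed.

Lemma measurable_exp_neg (t : R) :
  measurable_fun setT (fun l : measurableTypeR R => expR (- t * l)).
Proof. exact: measurableT_comp. Qed.

Lemma integral_exp_sq_fin (t : R) : 0 <= t ->
  (\int[mu]_l (expR (- t * l) ^+ 2)%:E < +oo)%E.
Proof.
move=> t0.
have mf : measurable_fun setT
    (fun l : measurableTypeR R => (expR (- t * l) ^+ 2)%:E).
  apply/measurable_EFinP; apply: measurable_funX; exact: measurable_exp_neg.
apply: le_lt_trans (fin_num_fun_lty (fin_num_measure mu)).
rewrite -[leRHS]mul1e -integral_cst//.
apply: ae_ge0_le_integral => //.
exists neg; split => // l /=; apply: contra_notP => ln _.
rewrite lee_fin -[leRHS](expr1n _ 2) ler_sqr ?nnegrE ?expR_ge0//.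
rewrite -expR0 ler_expR mulNr oppr_le0 mulr_ge0// leNgt.
by apply/negP => l0; apply: ln; rewrite /= in_itv.
Qed.

(** The measure lives on the half-line where the alternating Taylor bound
    holds, so that bound can be integrated. *)
Lemma integral_exp_taylor (n : nat) (t : R) : 0 <= t ->
  (forall k, mu.-integrable setT (fun l => (l ^+ k)%:E)) ->
  `| \int[mu]_l expR (- t * l)
     - \sum_(k < n.+1) ((- t) ^+ k / k`!%:R) * \int[mu]_l (l ^+ k) |
  <= t ^+ n.+1 / n.+1`!%:R * \int[mu]_l (l ^+ n.+1).
Proof.
move=> t0 il.
have iexp : mu.-integrable setT (fun l => (expR (- t * l))%:E).
  apply: integrable_square; last exact: integral_exp_sq_fin.
  exact: measurable_exp_neg.
pose D : set (measurableTypeR R) := setT `\` neg.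
have mD : measurable D by exact: measurableD.
have toD (f : R -> R) :
    mu.-integrable setT (EFin \o (f : measurableTypeR R -> R)) ->
    \int[mu]_l f l = \int[mu]_(l in D) f l.
  by move=> i; rewrite /Rintegral (negligible_integral mneg).
have iD (f : R -> R) :
    mu.-integrable setT (EFin \o (f : measurableTypeR R -> R)) ->
    mu.-integrable D (EFin \o f) by exact: integrableS.
have ipow k (c : R) : mu.-integrable setT (fun l => (c * l ^+ k)%:E).
  by under eq_fun do rewrite EFinM; exact: integrableZl.
pose p (m : nat) l := \sum_(k < m) (- t) ^+ k / k`!%:R * l ^+ k.
have pint m : mu.-integrable setT (fun l => (p m l)%:E) /\
    \int[mu]_l p m l = \sum_(k < m) ((- t) ^+ k / k`!%:R) * \int[mu]_l (l ^+ k).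
  elim: m => [|m [IHi IHe]].
    rewrite /p; under eq_fun do rewrite big_ord0.
    under eq_Rintegral do rewrite big_ord0.
    by rewrite big_ord0 Rintegral_cst// mul0r; split => //; exact: integrable0.
  have pS l : p m.+1 l = p m l + (- t) ^+ m / m`!%:R * l ^+ m.
    by rewrite /p big_ord_recr.
  split.
    under eq_fun do rewrite pS EFinD; exact: integrableD.
  under eq_Rintegral do rewrite pS.
  rewrite big_ord_recr /= -IHe -RintegralZl//; last exact: il.
  exact: (RintegralD measurableT IHi (ipow m _)).
have [ipn <-] := pint n.+1.
rewrite -RintegralB// -RintegralZl//; last exact: il.
have idiff : mu.-integrable setT (fun l => (expR (- t * l) - p n.+1 l)%:E).
  by under eq_fun do rewrite EFinB; exact: integrableB.
rewrite (toD _ idiff) (toD _ (ipow _ _)).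
apply: le_trans (le_normr_Rintegral _ (iD _ idiff)) _ => //.
apply: le_Rintegral => //.
- by apply: integrable_norm; exact: iD.
- exact: (iD _ (ipow _ _)).
move=> l [_ /= /negP]; rewrite in_itv /= -leNgt => l0.
have := expR_taylor_alternating n (mulr_ge0 t0 l0).
rewrite mulNr exprMn mulrAC; apply: le_trans.
rewrite le_eqVlt; apply/orP; left; apply/eqP; congr (`| _ - _ |).
by apply: eq_bigr => k _; rewrite -mulNr exprMn mulrAC.
Qed.

End LaplaceTaylor.

(** * Positivity of the spectrum *)

Section Positivity.
Variables (R : realType) (H : completeNormedModType R[i]).
Variable ip : {dot H for conjC}.
Hypothesis ip_norm : induces_norm ip.
Variable E : set (measurableTypeR R) -> H -> H.
Hypothesis hE : projection_valued_measure ip E.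
Local Notation mu := (spectral_mu hE ip_norm).
Local Notation Phi := (spectral_integral E).
Local Notation neg := (`]-oo, 0[%classic : set (measurableTypeR R)).

Lemma spectral_mu_proj N A x : measurable N -> measurable A ->
  mu (E N x) A = mu x (A `&` N).
Proof.
move=> mN mA; have mAN : measurable (A `&` N) by exact: measurableI.
rewrite /spectral_mu !(scalar_spectral_measureE ip_norm hE)//.
rewrite (pvmI hE)// (pvm_rip hE)//.
by rewrite setIC -setIA setIid.
Qed.

(** Positivity is tested on the vector [y] = [E neg x]: its scalar measure is
    the restriction of [mu x] to the negative numbers, so <y, Phi id y> is the
    integral of a negative function and can be nonnegative only if the measure
    vanishes. *)
Lemma nonneg_spectral_mu x :
  (forall y, dom (Phi id) y -> 0 <= ip y (Phi id y)) ->
  dom (Phi id) x -> mu x neg = 0%E.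
Proof.
move=> Phi_ge0 dx; have mneg : measurable neg by exact: measurable_itv.
have mC : measurable (~` neg) by exact: measurableC.
pose y := E neg x.
have muy A : measurable A -> mu y A = mu x (A `&` neg).
  exact: spectral_mu_proj.
have msq : measurable_fun setT (fun l : measurableTypeR R => (id l ^+ 2)%:E).
  by apply/measurable_EFinP/measurable_funX.
have dy : dom (Phi id) y.
  apply: le_lt_trans dx.
  apply: (@ge0_le_measure_integral _ _ _ (mu y) (mu x)) => //.
    move=> A mA; rewrite [leLHS](muy _ mA) le_measure ?inE//.
    exact: measurableI.
  by move=> l; rewrite lee_fin sqr_ge0.
have iy : (mu y).-integrable setT (EFin \o id).
  by apply: integrable_square.
have := Phi_ge0 _ dy.
rewrite (ip_spectral_integral ip_norm hE)// ler0c => int_ge0.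
have ynull : mu y (~` neg) = 0%E by rewrite muy// setICl measure0.
have mE : measurable_fun setT (fun l : measurableTypeR R => (l : R)%:E).
  exact/measurable_EFinP.
have eqN : (\int[mu y]_l `|(l : R)%:E| = \int[mu y]_l (- (l : R)%:E))%E.
  apply: ae_eq_integral => //.
  - exact: measurableT_comp mE.
  - exact: measurableT_comp mE.
  exists (~` neg); split => // l /=; apply: contra_notP => /contrapT.
  by rewrite /= in_itv /= => l0 _; rewrite ltr0_norm.
have int0 : (\int[mu y]_l `|(l : R)%:E| = 0)%E.
  apply/eqP; rewrite eq_le integral_ge0 ?andbT//.
  rewrite eqN integralN; last exact: integrable_add_def.
  by rewrite leeNl oppe0 -(fineK (integrable_fin_num _ iy)).
have [|N [mN N0 subN]] := (ae_eq_integral_abs (mu y) measurableT _).1 int0.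
  exact/measurable_EFinP.
rewrite -[neg]setIid -muy//; apply/eqP; rewrite eq_le measure_ge0 andbT -N0.
apply: le_measure; rewrite ?inE// => l /=; rewrite in_itv /= => l0.
by apply: subN => /= /(_ Logic.I) [le0]; rewrite le0 ltxx in l0.
Qed.

End Positivity.

(** * The heat semigroup between two vectors *)

Lemma exists_phase (R : realType) (z : R[i]) :
  exists a : R[i], `|a| = 1 /\ a * z = `|z|.
Proof.
have [->|z0] := eqVneq z 0; first by exists 1; rewrite normr1 mulr0 normr0.
exists (`|z| / z); split; last by rewrite divfK.
by rewrite normrM normr_id normfV divff// normr_eq0.
Qed.

Lemma ip_op_pow_eq0 (R : realType) (H : completeNormedModType R[i])
    (ip : {dot H for conjC}) (L : operator H) (f g : H) (n k : nat) :
  (n%:R%:E <= d_op ip L f g)%E -> (k < n)%N -> ip f (op_pow ip L k g) = 0.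
Proof.
move=> nd kn; apply/eqP; apply: contraT => fk.
have : (d_op ip L f g <= k%:R%:E)%E by apply: ereal_inf_lbound; exists k.
by move/(le_trans nd); rewrite lee_fin ler_nat leqNgt kn.
Qed.

Theorem lemma1p2 (R : realType) (H : completeNormedModType R[i])
    (ip : {dot H for conjC}) (ip_norm : induces_norm ip)
    (L : operator H) (L_sa : selfadjoint ip L) (L_ge0 : nonneg_operator ip L)
    (f g : H)
    (f_dom : forall n : nat, dom (op_pow ip L n) f)
    (g_dom : forall n : nat, dom (op_pow ip L n) g)
    (n : nat) (n_le_d : (n%:R%:E <= d_op ip L f g)%E)
    (t : R) (t_ge0 : 0 <= t) :
  `| ip f (heat_op ip t L g)
     - ((- t) ^+ n)%:C * (ip f (op_pow ip L n g) / n`!%:R) |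
  <= (t ^+ n.+1)%:C
     * ((ip f (op_pow ip L n.+1 f) + ip g (op_pow ip L n.+1 g))
        / (2 * (n.+1)`!%:R)).
Proof.
set T := ip f (heat_op ip t L g) - _.
(* The domain of a power is empty unless [L] has a spectral measure. *)
have [[hE gL] _] := f_dom 0%N.
set E := spectral_measure ip L in hE gL.
pose mu := spectral_mu hE ip_norm.
pose pow k := fun l : R => l ^+ k.
pose heat := fun l : R => expR (- t * l).
pose P k := spectral_integral E (pow k).
have mpow k : measurable_fun setT (pow k : measurableTypeR R -> R).
  exact: exprn_measurable.
have mheat : measurable_fun setT (heat : measurableTypeR R -> R).
  exact: measurable_exp_neg.
have fP k : dom (P k) f by have [] := f_dom k.
have gP k : dom (P k) g by have [] := g_dom k.
have [a [a1 aT]] := exists_phase T.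
have domZ (b : R[i]) z k : dom (P k) z -> dom (P k) (b *: z).
  exact: (dom_spectral_integralZ ip_norm hE (mpow k)).
have domD y z k : dom (P k) y -> dom (P k) z -> dom (P k) (y + z).
  exact: (dom_spectral_integralD ip_norm hE (mpow k)).
have daf k : dom (P k) (a *: f) by exact: domZ.
have dNg k : dom (P k) (- g) by rewrite -scaleN1r; exact: domZ.
have Phi_ge0 y : dom (spectral_integral E id) y ->
    0 <= ip y (spectral_integral E id y).
  move=> dy.
  have : graph (spectral_integral E id) (y, spectral_integral E id y) by [].
  rewrite -gL => -[/= Ly ->]; exact: L_ge0.
(* [pow 1] and the identity are convertible. *)
have neg0 (z : H) : dom (P 1%N) z -> mu z `]-oo, 0[%classic = 0%E.
  exact: (nonneg_spectral_mu ip_norm hE).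
have intP (z : H) k : dom (P k) z ->
    (mu z).-integrable setT (fun l => (l ^+ k)%:E).
  move=> dz; exact: (integrable_square (mpow k)).
have heatP (z : H) : dom (P 1%N) z -> dom (spectral_integral E heat) z.
  move=> dz; exact: (integral_exp_sq_fin (neg0 _ dz)).
pose c k : R := (- t) ^+ k / k`!%:R.
pose M k (z : H) : R := \int[mu z]_l (l ^+ k).
pose D (z : H) : R := \int[mu z]_l heat l - \sum_(k < n.+1) c k * M k z.
have Dle (z : H) : (forall k, dom (P k) z) ->
    `|D z| <= t ^+ n.+1 / n.+1`!%:R * M n.+1 z.
  move=> dz; apply: integral_exp_taylor => //; first exact: neg0.
  by move=> k; exact: intP.
(* The terms with [k < n] vanish, so the whole Taylor polynomial can be
   subtracted instead of its last term. *)
have TE : T = ip f (heat_op ip t L g) - \sum_(k < n.+1) (c k)%:C * ip f (P k g).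
  rewrite big_ord_recr big1 /= ?add0r.
    by rewrite /T /c rmorphM fmorphV rmorph_nat mulrCA mulrC -mulrA.
  by move=> k _; rewrite [ip f _](ip_op_pow_eq0 n_le_d)// mulr0.
(* The phase turns the modulus into a real part, to which polarization
   applies term by term. *)
have normT : `|T| = (4^-1 * (D (a *: f + g) - D (a *: f - g)))%:C.
  have -> : `|T| = (complex.Re (a * T))%:C.
    by rewrite aT RRe_real// ger0_real.
  congr _%:C.
  have aE y : complex.Re (a * ip f y) = re_ip ip (a *: f) y.
    by rewrite /re_ip linearZl_LR.
  have pol k : re_ip ip (a *: f) (P k g) =
      4^-1 * (M k (a *: f + g) - M k (a *: f - g)).
    exact: (spectral_integral_polarization ip_norm hE (mpow k) (daf k) (gP k)).
  have polh : re_ip ip (a *: f) (heat_op ip t L g) =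
      4^-1 * (\int[mu (a *: f + g)]_l heat l - \int[mu (a *: f - g)]_l heat l).
    exact: (spectral_integral_polarization ip_norm hE mheat (heatP _ (daf 1%N))
      (heatP _ (gP 1%N))).
  rewrite TE mulrBr mulr_sumr ReD ReN Re_sum aE polh.
  under eq_bigr => k _ do rewrite mulrCA ReZ aE pol mulrCA mulrBr.
  rewrite -mulr_sumr sumrB /D; ring.
have par k : M k (a *: f + g) + M k (a *: f - g) = 2 * (M k f + M k g).
  exact: (spectral_integral_parallelogram ip_norm hE (mpow k) a1 (fP k) (gP k)).
have MP k z : dom (P k) z -> ip z (op_pow ip L k z) = (M k z)%:C.
  exact: (ip_spectral_integral ip_norm hE (mpow k)).
rewrite normT !MP// -rmorphD -natrM -(rmorph_nat (real_complex R)).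
rewrite -fmorphV -!rmorphM lecR.
have h1 := Dle _ (fun k => domD _ _ _ (daf k) (gP k)).
have h2 := Dle _ (fun k => domD _ _ _ (daf k) (dNg k)).
have h3 : 4^-1 * (D (a *: f + g) - D (a *: f - g)) <=
    4^-1 * (t ^+ n.+1 / n.+1`!%:R * M n.+1 (a *: f + g) +
            t ^+ n.+1 / n.+1`!%:R * M n.+1 (a *: f - g)).
  rewrite ler_pM2l ?invr_gt0//; apply: le_trans (lerD h1 h2).
  exact: le_trans (ler_norm _) (ler_normB _ _).
apply: le_trans h3 _; rewrite -mulrDr par.
rewrite le_eqVlt; apply/orP; left; apply/eqP.
have F0 : n.+1`!%:R != 0 :> R by rewrite pnatr_eq0 -lt0n fact_gt0.
rewrite natrM; move: F0; set F := n.+1`!%:R => F0.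
by field.
Qed.
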